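(* Let $X\subseteq\mathbb{R}^n$ be nonempty, closed, convex and bounded, and let $F:X\to\mathbb{R}^n$ be monotone on $X$ (i.e. $\langle F(x)-F(y),x-y\rangle\ge 0$ for all $x,y\in X$) and satisfy, for some $\nu\in[0,\infty)$, $L_\nu>0$, $M_\nu\ge 0$, the growth condition $\|F(x)-F(y)\|_*\le L_\nu\|x-y\|^\nu+M_\nu$ for all $x,y\in X$. Let the samples satisfy the unbiasedness and bounded-variance conditions (with variance bound $\sigma^2$) stated in the context. Let $D>0$ satisfy $\max_{x,z\in X}B_\psi(z,x)\le D$ and set $$\widehat D=\begin{cases}\dfrac{2^{2+\nu}L_\nu^2D^\nu}{\alpha^{1+\nu}}+\dfrac{17\sigma^2+16M_\nu^2}{2\alpha}&\text{if }\nu>0,\\[2mm]\dfrac{9\sigma^2+2(L_0+M_0)^2}{2\alpha}&\text{if }\nu=0.\end{cases}$$ Then, for the stochastic Popov mirror-prox algorithm with diminishing step size $\gamma_t=\frac{c}{(t+1)^a}$, where $c>0$ and $0<a<1$, we have for any $T\ge1$ $$\mathsf{E}\left[G\left(\frac{\sum_{t=0}^T\gamma_t^{-1}y_{t+1}}{\sum_{t=0}^T\gamma_t^{-1}}\right)\right]\le\frac{2\cdot4^a(1+a)D}{cT^{1-a}}+\frac{2\widehat Dc(1+a)}{T^a}.$$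
   Context: $\|\cdot\|$ is an arbitrary norm on $\mathbb{R}^n$, $\langle\cdot,\cdot\rangle$ the standard inner product, and $\|x\|_*=\max_{\|z\|\le1}\langle x,z\rangle$ the conjugate norm. For $\nu=0$ the term $\|x-y\|^0$ is read as $1$, and $L_0,M_0$ denote $L_\nu,M_\nu$ at $\nu=0$. The function $\psi:X\to\mathbb{R}$ is continuously differentiable and $\alpha$-strongly convex for some $\alpha>0$: $\psi(z)\ge\psi(x)+\langle\nabla\psi(x),z-x\rangle+\frac{\alpha}{2}\|z-x\|^2$ for all $x,z\in X$. Its Bregman divergence is $B_\psi(z,x)=\psi(z)-\psi(x)-\langle\nabla\psi(x),z-x\rangle$, $x,z\in X$. $F(x)=\mathsf{E}[\widehat F(x,\xi)]$ for all $x\in X$, where $\xi$ is a random variable with values in a set $\Omega$. Stochastic Popov mirror-prox algorithm: $x_0\in X$ is random with $\mathsf{E}[\|x_0\|^2]<\infty$, $y_0=x_0$, and for $t\ge0$ with step size $\gamma_t>0$, $$y_{t+1}=\operatorname*{argmin}_{z\in X}\left[\langle\gamma_t\widehat F(y_t,\xi_t)-\nabla\psi(x_t),z\rangle+\psi(z)\right],$$ $$x_{t+1}=\operatorname*{argmin}_{z\in X}\left[\langle\gamma_t\widehat F(y_{t+1},\xi_{t+1})-\nabla\psi(x_t),z\rangle+\psi(z)\right],$$ where $\xi_t\in\Omega$ is the random sample drawn at the iterate $y_t$. Information: $\mathcal{F}_{-1}=\{x_0\}$ and $\mathcal{F}_t=\{x_0\}\cup\{\xi_\tau\}_{\tau=0}^t$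 for $t\ge0$ (conditioning is on the generated $\sigma$-algebras). Sampling conditions: for all $z\in X$ and $t\ge0$, $\mathsf{E}[\widehat F(z,\xi_t)\mid\mathcal{F}_{t-1}]=F(z)$ and $\mathsf{E}[\|\widehat F(z,\xi_t)-F(z)\|_*^2\mid\mathcal{F}_{t-1}]\le\sigma^2$; these are understood to apply also at the $\mathcal{F}_{t-1}$-measurable point $z=y_t$ at which $\xi_t$ is drawn. Dual gap function: $G(x)=\sup_{z\in X}\langle F(z),x-z\rangle$ for $x\in X$. *)

(* Defs.v *)
From HB Require Import structures.
From mathcomp Require Import all_boot all_order all_algebra.
From mathcomp Require Import all_classical all_reals all_analysis.

Set Implicit Arguments.
Unset Strict Implicit.
Unset Printing Implicit Defensive.

Import Order.TTheory GRing.Theory Num.Theory.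
Import numFieldNormedType.Exports.

Local Open Scope classical_set_scope.
Local Open Scope ring_scope.

(* R^n with its Borel sigma-algebra, for use as a measurableType. *)
Definition borelV (R : realType) (n : nat) :=
  g_sigma_algebraType (@open 'rV[R]_n).

Definition inner (R : realType) (n : nat) (x z : 'rV[R]_n) : R :=
  \sum_(i < n) x ord0 i * z ord0 i.

(* Nonnegativity is omitted: it follows from the triangle inequality and
   homogeneity. *)
Definition is_norm (R : realType) (n : nat) (nrm : 'rV[R]_n -> R) : Prop :=
  [/\ forall x z, nrm (x + z) <= nrm x + nrm z,
      forall (k : R) x, nrm (k *: x) = `|k| * nrm x
    & forall x, nrm x = 0 -> x = 0].

(* The real-valued [sup] is meaningful here: for a norm [nrm] the set is nonempty
   and bounded. *)
Definition conj_norm (R : realType) (n : nat) (nrm : 'rV[R]_n -> R)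
    (x : 'rV[R]_n) : R :=
  sup [set inner x z | z in [set z | nrm z <= 1]].

(* [psi] is differentiable on [X] with gradient map [dpsi] and [dpsi] is continuous
   on [X].  As [psi] matters only on [X], limits are taken within [X]; when [X] has
   empty interior [dpsi] need not be determined by [psi], hence it is an argument.
   The topology and the norm [`|z - x|] are those of ['rV[R]_n] (sup norm). *)
Definition C1_on (R : realType) (n : nat) (X : set 'rV[R]_n)
    (psi : 'rV[R]_n -> R) (dpsi : 'rV[R]_n -> 'rV[R]_n) : Prop :=
  (forall x, X x -> forall e : R, 0 < e ->
     \forall z \near within X (nbhs x),
       `|psi z - psi x - inner (dpsi x) (z - x)| <= e * `|z - x|) /\
  {within X, continuous dpsi}.

Definition strongly_convex_on (R : realType) (n : nat) (nrm : 'rV[R]_n -> R)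
    (X : set 'rV[R]_n) (alpha : R)
    (psi : 'rV[R]_n -> R) (dpsi : 'rV[R]_n -> 'rV[R]_n) : Prop :=
  forall x z, X x -> X z ->
    psi x + inner (dpsi x) (z - x) + alpha / 2 * nrm (z - x) ^+ 2 <= psi z.

Definition bregman (R : realType) (n : nat) (psi : 'rV[R]_n -> R)
    (dpsi : 'rV[R]_n -> 'rV[R]_n) (z x : 'rV[R]_n) : R :=
  psi z - psi x - inner (dpsi x) (z - x).

Definition monotone_on (R : realType) (n : nat) (X : set 'rV[R]_n)
    (F : 'rV[R]_n -> 'rV[R]_n) : Prop :=
  forall x y, X x -> X y -> 0 <= inner (F x - F y) (x - y).

(* [powR] satisfies [0 `^ 0 = 1], so for [nu = 0] the power term is 1. *)
Definition growth_on (R : realType) (n : nat) (nrm : 'rV[R]_n -> R)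
    (X : set 'rV[R]_n) (F : 'rV[R]_n -> 'rV[R]_n) (nu L M : R) : Prop :=
  forall x y, X x -> X y ->
    conj_norm nrm (F x - F y) <= L * nrm (x - y) `^ nu + M.

Definition dual_gap (R : realType) (n : nat) (X : set 'rV[R]_n)
    (F : 'rV[R]_n -> 'rV[R]_n) (x : 'rV[R]_n) : \bar R :=
  ereal_sup [set (inner (F z) (x - z))%:E | z in X].

Definition is_argmin (R : realType) (n : nat) (X : set 'rV[R]_n)
    (f : 'rV[R]_n -> R) (z : 'rV[R]_n) : Prop :=
  X z /\ forall z', X z' -> f z <= f z'.

Definition jointly_measurable_on d' (Om : measurableType d') (R : realType)
    (n : nat) (X : set 'rV[R]_n) (Fhat : 'rV[R]_n -> Om -> 'rV[R]_n) : Prop :=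
  @measurable_fun _ _ (borelV R n * Om)%type (borelV R n) (X `*` setT)
    (fun p => Fhat p.1 p.2).

(* [Z] is a version of the conditional expectation of [Y] given the
   sub-sigma-algebra [G]. *)
Definition is_cond_exp d (T : measurableType d) (R : realType)
    (P : probability T R) (G : set (set T)) (Y Z : T -> R) : Prop :=
  [/\ P.-integrable setT (EFin \o Y),
      P.-integrable setT (EFin \o Z),
      forall B : set R, measurable B -> G (Z @^-1` B)
    & forall A, G A -> (\int[P]_(w in A) (Y w)%:E = \int[P]_(w in A) (Z w)%:E)%E].

Definition cond_exp_eq d (T : measurableType d) (R : realType)
    (P : probability T R) (G : set (set T)) (Y Z : T -> R) : Prop :=
  exists2 E : T -> R, is_cond_exp P G Y E & {ae P, forall w, E w = Z w}.

Definition cond_exp_le d (T : measurableType d) (R : realType)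
    (P : probability T R) (G : set (set T)) (Y Z : T -> R) : Prop :=
  exists2 E : T -> R, is_cond_exp P G Y E & {ae P, forall w, E w <= Z w}.

(* The sigma-algebra generated by [x0] and [xi 0, ..., xi t.-1], so that
   [past x0 xi t] is the information F_{t-1} (F_{-1} being [past x0 xi 0]). *)
Definition past d d' (T : measurableType d) (Om : measurableType d')
    (R : realType) (n : nat) (x0 : T -> borelV R n) (xi : nat -> T -> Om)
    (t : nat) : set (set T) :=
  <<s preimage_set_system setT x0 measurable `|`
      \bigcup_(s in `I_t) preimage_set_system setT (xi s) measurable >>.

(* Unbiasedness and variance bound [sigma ^+ 2], conditionally on [G], for the
   sample [s] drawn at the possibly random point [z]. *)
Definition sampling_at d d' (T : measurableType d) (Om : measurableType d')
    (R : realType) (n : nat) (P : probability T R) (nrm : 'rV[R]_n -> R)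
    (Fhat : 'rV[R]_n -> Om -> 'rV[R]_n) (F : 'rV[R]_n -> 'rV[R]_n) (sigma : R)
    (G : set (set T)) (s : T -> Om) (z : T -> 'rV[R]_n) : Prop :=
  (forall i, cond_exp_eq P G (fun w => Fhat (z w) (s w) ord0 i)
                             (fun w => F (z w) ord0 i)) /\
  cond_exp_le P G (fun w => conj_norm nrm (Fhat (z w) (s w) - F (z w)) ^+ 2)
                  (fun=> sigma ^+ 2).

Definition popov d d' (T : measurableType d) (Om : measurableType d')
    (R : realType) (n : nat) (X : set 'rV[R]_n)
    (psi : 'rV[R]_n -> R) (dpsi : 'rV[R]_n -> 'rV[R]_n)
    (Fhat : 'rV[R]_n -> Om -> 'rV[R]_n) (gamma : nat -> R)
    (x0 : T -> 'rV[R]_n) (xi : nat -> T -> Om)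
    (x y : nat -> T -> 'rV[R]_n) : Prop :=
  forall w : T,
    [/\ x 0%N w = x0 w, y 0%N w = x0 w
      & forall t : nat,
        is_argmin X (fun z => inner (gamma t *: Fhat (y t w) (xi t w)
                                     - dpsi (x t w)) z + psi z) (y t.+1 w) /\
        is_argmin X (fun z => inner (gamma t *: Fhat (y t.+1 w) (xi t.+1 w)
                                     - dpsi (x t w)) z + psi z) (x t.+1 w)].

Definition step_size (R : realType) (c a : R) (t : nat) : R :=
  c / (t.+1%:R `^ a).

Definition weighted_average (R : realType) (n : nat) (gamma : nat -> R) (N : nat)
    (y : nat -> 'rV[R]_n) : 'rV[R]_n :=
  (\sum_(0 <= t < N.+1) (gamma t)^-1)^-1 *:
    \sum_(0 <= t < N.+1) (gamma t)^-1 *: y t.+1.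

Definition Dhat (R : realType) (alpha D sigma nu L M : R) : R :=
  if nu == 0 then (9 * sigma ^+ 2 + 2 * (L + M) ^+ 2) / (2 * alpha)
  else 2 `^ (2 + nu) * L ^+ 2 * D `^ nu / alpha `^ (1 + nu)
       + (17 * sigma ^+ 2 + 16 * M ^+ 2) / (2 * alpha).

(* Main.v *)
(* With F^_t = Fhat (y_t, xi_t) and e_t its noise, the optimality conditions of the two prox
   steps and Young's inequality give, for z in X,
     gamma_t <F^_{t+1}, y_{t+1} - z> <= B(z, x_t) - B(z, x_{t+1})
                                        + gamma_t^2 / (2 alpha) |F^_{t+1} - F^_t|_*^2.
   The noise term - gamma_t <e_{t+1}, y_{t+1} - z> cannot be averaged directly since the
   gap takes a supremum over z; it is split with an auxiliary prox sequence u_t driven by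
   - e_t, for which - gamma_t <e_{t+1}, u_t - z> telescopes as well, up to
   gamma_t^2 / (2 alpha) |e_{t+1}|_*^2, while <e_{t+1}, y_{t+1} - u_t> has mean zero because
   y_{t+1} and u_t depend on the past only (the prox map is continuous, hence Borel).
   Dividing by gamma_t^2 and summing, each of the two telescoping sums is at most
   D / gamma_N^2. *)
Require Import Defs.
From HB Require Import structures.
From mathcomp Require Import all_boot all_order all_algebra.
From mathcomp Require Import ring lra.
From mathcomp Require Import all_classical all_reals all_analysis.
From mathcomp Require Import measurable_realfun.

Set Implicit Arguments.
Unset Strict Implicit.
Unset Printing Implicit Defensive.

Import Order.TTheory GRing.Theory Num.Theory.
Import numFieldNormedType.Exports.

Local Open Scope classical_set_scope.
Local Open Scope ring_scope.

(** * Lipschitz maps between normed spaces *)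

Lemma near_dist_le {R : realType} {V : normedModType R} (x : V) (e : R) :
  0 < e -> \forall y \near x, `|x - y| <= e.
Proof. by move=> e0; apply: (@cvgr_dist_le _ _ _ (nbhs x) _ id x cvg_id). Qed.

Lemma dist_le_continuous {R : realType} {V W : normedModType R} (C : R)
  (f : V -> W) : (forall x y, `|f x - f y| <= C * `|x - y|) -> continuous f.
Proof.
move=> lip x; apply/cvgrPdist_le => e e0.
have C1 : 0 < `|C| + 1 by rewrite ltr_wpDl.
apply: filterS (near_dist_le x (divr_gt0 e0 C1)) => y.
rewrite ler_pdivlMr// => h; apply: le_trans (lip x y) (le_trans _ h).
by rewrite mulrC ler_wpM2l// (le_trans (ler_norm _))// lerDl.
Qed.

(** * Bilinearity and size of the standard inner product *)

Section Inner.
Context {R : realType} {n : nat}.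
Implicit Types (x y z : 'rV[R]_n) (k : R).

Lemma innerC x y : inner x y = inner y x.
Proof. by apply: eq_bigr => i _; rewrite mulrC. Qed.

Lemma innerDl x y z : inner (x + y) z = inner x z + inner y z.
Proof. by rewrite /inner -big_split; apply: eq_bigr => i _; rewrite mxE mulrDl. Qed.

Lemma innerZl k x y : inner (k *: x) y = k * inner x y.
Proof. by rewrite /inner mulr_sumr; apply: eq_bigr => i _; rewrite mxE mulrA. Qed.

Lemma innerDr x y z : inner z (x + y) = inner z x + inner z y.
Proof. by rewrite innerC innerDl !(innerC z). Qed.

Lemma innerZr k x y : inner x (k *: y) = k * inner x y.
Proof. by rewrite innerC innerZl innerC. Qed.

Lemma innerNl x y : inner (- x) y = - inner x y.
Proof. by rewrite -scaleN1r innerZl mulN1r. Qed.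

Lemma innerNr x y : inner x (- y) = - inner x y.
Proof. by rewrite innerC innerNl innerC. Qed.

Lemma innerBl x y z : inner (x - y) z = inner x z - inner y z.
Proof. by rewrite innerDl innerNl. Qed.

Lemma innerBr x y z : inner z (x - y) = inner z x - inner z y.
Proof. by rewrite innerDr innerNr. Qed.

Lemma inner0r x : inner x 0 = 0.
Proof. by rewrite -(scale0r 0) innerZr mul0r. Qed.

Definition innerE := (innerDl, innerDr, innerNl, innerNr, innerZl, innerZr).

Lemma inner_sumr x I (s : seq I) (f : I -> 'rV[R]_n) :
  inner x (\sum_(i <- s) f i) = \sum_(i <- s) inner x (f i).
Proof.
elim: s => [|i s IH]; first by rewrite !big_nil inner0r.
by rewrite !big_cons innerDr IH.
Qed.

Lemma normr_coord x i : `|x ord0 i| <= `|x|.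
Proof.
rewrite [leRHS]/Num.norm /= mx_normrE.
by apply/bigmax_geP; right; exists (ord0, i).
Qed.

(** The norm here is the sup norm, hence the factor [n]; it enters continuity and boundedness
    arguments only, never the final constants. *)
Lemma normr_inner_le x y : `|inner x y| <= n%:R * (`|x| * `|y|).
Proof.
apply: le_trans (ler_norm_sum _ _ _) _.
apply: (@le_trans _ _ (\sum_(i < n) `|x| * `|y|)).
  by apply: ler_sum => i _; rewrite normrM ler_pM// normr_coord.
by rewrite sumr_const card_ord mulr_natl.
Qed.


End Inner.

(** * Equivalence of norms, the conjugate norm and Young's inequality *)

Section ConjNorm.
Context {R : realType} {n : nat}.
Variables (nrm : 'rV[R]_n -> R) (hnrm : is_norm nrm).
Implicit Types (x y z : 'rV[R]_n) (k : R).

Lemma nrmD x y : nrm (x + y) <= nrm x + nrm y. Proof. by case: hnrm. Qed.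

Lemma nrmZ k x : nrm (k *: x) = `|k| * nrm x. Proof. by case: hnrm. Qed.

Lemma nrm0_eq0 x : nrm x = 0 -> x = 0. Proof. by case: hnrm => _ _; exact. Qed.

Lemma nrm0 : nrm 0 = 0.
Proof. by rewrite -(scale0r 0) nrmZ normr0 mul0r. Qed.

Lemma nrmN x : nrm (- x) = nrm x.
Proof. by rewrite -scaleN1r nrmZ normrN1 mul1r. Qed.

Lemma nrm_ge0 x : 0 <= nrm x.
Proof. by have := nrmD x (- x); rewrite subrr nrm0 nrmN; lra. Qed.

Lemma nrm_le_normr : exists2 C : R, 0 <= C & forall x, nrm x <= C * `|x|.
Proof.
exists (\sum_(i < n) nrm (delta_mx ord0 i)) => [|x].
  by apply: sumr_ge0 => i _; exact: nrm_ge0.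
rewrite [x in nrm x]row_sum_delta mulr_suml.
have : forall s : seq 'I_n, nrm (\sum_(j <- s) x ord0 j *: delta_mx 0 j) <=
    \sum_(i <- s) nrm (delta_mx ord0 i) * `|x|.
  elim=> [|i s IH]; first by rewrite !big_nil nrm0.
  rewrite !big_cons; apply: le_trans (nrmD _ _) _; apply: lerD IH.
  by rewrite nrmZ mulrC ler_wpM2l ?nrm_ge0// normr_coord.
exact.
Qed.

Lemma continuous_nrm : continuous nrm.
Proof.
have [C C0 hC] := nrm_le_normr.
have lip x y : `|nrm x - nrm y| <= C * `|x - y|.
  rewrite ler_norml; apply/andP; split.
    have := nrmD (y - x) x; have := hC (y - x); rewrite subrK distrC; lra.
  by have := nrmD (x - y) y; have := hC (x - y); rewrite subrK; lra.
exact: dist_le_continuous lip.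
Qed.

(** By compactness [nrm] attains its minimum over the sup-norm unit sphere; definiteness makes this
    minimum positive, and homogeneity makes its inverse a valid constant. *)
Lemma normr_le_nrm : exists2 C : R, 0 <= C & forall x, `|x| <= C * nrm x.
Proof.
pose S : set 'rV[R]_n := [set x | `|x| = 1].
have [S0|/set0P/negP] := pselect (S !=set0); last first.
  (* With an empty sphere every vector is zero, so the constant [0] works. *)
  rewrite negbK => /eqP S0; exists 0 => // x; rewrite mul0r.
  have [->|x0] := eqVneq x 0; first by rewrite normr0.
  suff : S (`|x|^-1 *: x) by rewrite S0.
  by rewrite /S/= normrZ normfV normr_id mulVf// normr_eq0.
have cS : compact S.
  apply: bounded_closed_compact.
    by exists 1; split=> // M M1 x /= ->; exact: ltW.
  rewrite (_ : S = Num.norm @^-1` [set 1]); last by [].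
  by apply: closed_comp => [x _|]; [exact: norm_continuous|exact: closed_eq].
have [v] := compact_EVT_min S0 cS (continuous_subspaceT continuous_nrm).
rewrite inE => Sv hv.
have nv : 0 < nrm v.
  rewrite lt_neqAle nrm_ge0 andbT eq_sym; apply/eqP => /nrm0_eq0 v0.
  by move: Sv; rewrite /S/= v0 normr0 => /eqP; rewrite eq_sym oner_eq0.
exists (nrm v)^-1 => [|x]; first by rewrite invr_ge0 ltW.
have [->|x0] := eqVneq x 0; first by rewrite normr0 nrm0 mulr0.
have xp : 0 < `|x| by rewrite normr_gt0.
have := hv (`|x|^-1 *: x).
rewrite inE /S/= normrZ normfV normr_id mulVf ?normr_eq0// => /(_ erefl).
by rewrite nrmZ normfV normr_id ler_pdivlMl// mulrC -ler_pdivlMl.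
Qed.

Let unit_values x : set R := [set inner x z | z in [set z | nrm z <= 1]].

(** By equivalence of norms the unit ball of [nrm] is bounded in sup norm. *)
Let has_sup_unit_values x : has_sup (unit_values x).
Proof.
split; first by exists (inner x 0); exists 0 => //=; rewrite nrm0.
have [C C0 hC] := normr_le_nrm.
exists (n%:R * (`|x| * C)) => _ [z /= z1 <-].
apply: le_trans (ler_norm _) _; apply: le_trans (normr_inner_le _ _) _.
rewrite ler_wpM2l// ler_wpM2l//; apply: le_trans (hC z) _.
by rewrite -[leRHS]mulr1 ler_wpM2l.
Qed.

Lemma inner_le_conj_norm x z : inner x z <= conj_norm nrm x * nrm z.
Proof.
have [->|z0] := eqVneq z 0; first by rewrite inner0r nrm0 mulr0.
have zp : 0 < nrm z.
  by rewrite lt_neqAle nrm_ge0 andbT eq_sym; apply: contra_neq z0 => /nrm0_eq0.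
rewrite -ler_pdivrMr// mulrC -innerZr.
apply: sup_upper_bound; first exact: has_sup_unit_values.
exists ((nrm z)^-1 *: z) => //=.
by rewrite nrmZ normfV (gtr0_norm zp) mulVf ?gt_eqF.
Qed.

Lemma conj_norm_le x k : (forall z, nrm z <= 1 -> inner x z <= k) ->
  conj_norm nrm x <= k.
Proof.
move=> h; apply: sup_le_ub; first by case: (has_sup_unit_values x).
by move=> _ [z /= + <-]; exact: h.
Qed.

Lemma conj_norm_ge0 x : 0 <= conj_norm nrm x.
Proof.
rewrite -(inner0r x); apply: sup_upper_bound; first exact: has_sup_unit_values.
by exists 0 => //=; rewrite nrm0.
Qed.

Lemma inner_le_conj_norm1 x z : nrm z <= 1 -> inner x z <= conj_norm nrm x.
Proof.
move=> z1; apply: le_trans (inner_le_conj_norm _ _) _.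
by rewrite -[leRHS]mulr1 ler_wpM2l// conj_norm_ge0.
Qed.

Lemma conj_normD x y : conj_norm nrm (x + y) <= conj_norm nrm x + conj_norm nrm y.
Proof.
apply: conj_norm_le => z z1.
by rewrite innerDl lerD// inner_le_conj_norm1.
Qed.

Lemma conj_normN x : conj_norm nrm (- x) = conj_norm nrm x.
Proof.
suff h y : conj_norm nrm (- y) <= conj_norm nrm y.
  by apply/eqP; rewrite eq_le h /= -{1}(opprK x) h.
apply: conj_norm_le => z z1.
by rewrite innerNl -innerNr inner_le_conj_norm1// nrmN.
Qed.

(** Duality at [z] and at [- z] bounds the absolute value of the inner product, so [g] may have any
    sign; what remains is a completed square. *)
Lemma inner_young alpha g x z : 0 < alpha ->
  g * inner x z <= g ^+ 2 / (2 * alpha) * conj_norm nrm x ^+ 2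
                   + alpha / 2 * nrm z ^+ 2.
Proof.
move=> a0.
have h : g * inner x z <= `|g| * (conj_norm nrm x * nrm z).
  apply: le_trans (ler_norm _) _; rewrite normrM ler_wpM2l// ler_norml.
  rewrite inner_le_conj_norm andbT lerNl -innerNr -(nrmN z).
  exact: inner_le_conj_norm.
apply: le_trans h _; rewrite -real_normK ?num_real//.
set G := `|g|; set c := conj_norm _ _; set m := nrm z.
have -> : G ^+ 2 / (2 * alpha) * c ^+ 2 + alpha / 2 * m ^+ 2 =
   G * (c * m) + (G * c - alpha * m) ^+ 2 / (2 * alpha).
  by field; rewrite gt_eqF.
by rewrite lerDl divr_ge0 ?sqr_ge0// mulr_ge0// ltW.
Qed.

End ConjNorm.

(** * Convexity, Bregman divergences and the prox map *)

Lemma convex_set_segment {R : realType} {V : lmodType R} (X : set V) (y z : V)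
    (h : R) : convex_set X -> X y -> X z -> 0 <= h -> h <= 1 ->
  X (y + h *: (z - y)).
Proof.
move=> cX Xy Xz h0 h1; have := cX z y (Itv01 h0 h1).
rewrite !inE => /(_ Xz Xy); rewrite /conv /=.
by rewrite /unstable.onem scalerBl scale1r scalerBr addrCA.
Qed.

Section Prox.
Context {R : realType} {n : nat}.
Variables (nrm : 'rV[R]_n -> R) (hnrm : is_norm nrm).
Variables (X : set 'rV[R]_n) (X_nonempty : X !=set0) (X_closed : closed X).
Hypotheses (X_convex : convex_set X) (X_bounded : bounded_set X).
Variables (alpha : R) (alpha_gt0 : 0 < alpha).
Variables (psi : 'rV[R]_n -> R) (dpsi : 'rV[R]_n -> 'rV[R]_n).
Hypotheses (psi_C1 : C1_on X psi dpsi)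
  (psi_sc : strongly_convex_on nrm X alpha psi dpsi).
Implicit Types (x y z p q u : 'rV[R]_n).

Local Notation argmin p := (is_argmin X (fun z => inner p z + psi z)).
Local Notation B := (bregman psi dpsi).

Lemma bregman_ge x z : X x -> X z -> alpha / 2 * nrm (z - x) ^+ 2 <= B z x.
Proof. by move=> Xx Xz; have := psi_sc Xx Xz; rewrite /bregman; lra. Qed.

Lemma bregman_ge0 x z : X x -> X z -> 0 <= B z x.
Proof.
move=> Xx Xz; apply: le_trans (bregman_ge Xx Xz).
by rewrite mulr_ge0 ?sqr_ge0// divr_ge0// ltW.
Qed.

Lemma within_psi_continuous : {within X, continuous psi}.
Proof.
apply/subspace_continuousP => x Xx; apply/cvgrPdist_le => /= e e0.
(* The linear part of [psi] contributes the first summand, a first-order remainder of slope [1] the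
   second. *)
pose C := n%:R * `|dpsi x| + 1.
have C0 : 0 < C by rewrite /C ltr_wpDl// mulr_ge0.
have /= h1 := psi_C1.1 x Xx 1 ltr01.
have h2 : \forall z \near within X (nbhs x), `|x - z| <= e / C.
  apply: filterS (near_dist_le x (divr_gt0 e0 C0)) => z h _; exact: h.
apply: filterS2 h1 h2 => z h1; rewrite ler_pdivlMr// => h2.
have h3 := normr_inner_le (dpsi x) (z - x).
rewrite distrC; apply: le_trans h2; rewrite (distrC x) /C.
rewrite (_ : psi z - psi x =
  (psi z - psi x - inner (dpsi x) (z - x)) + inner (dpsi x) (z - x)); last by ring.
apply: le_trans (ler_normD _ _) _; lra.
Qed.

Lemma within_inner_psi_continuous p :
  {within X, continuous (fun z => inner p z + psi z)}.
Proof.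
apply/subspace_continuousP => x Xx; apply: cvgD.
  apply: (cvg_within_filter (f := inner p)).
  apply: (@dist_le_continuous _ _ _ (n%:R * `|p|)) => y z.
  by rewrite -innerBr -mulrA; exact: normr_inner_le.
by move/subspace_continuousP : within_psi_continuous; exact.
Qed.

Lemma argmin_exists p : exists z, argmin p z.
Proof.
have [z Xz hz] := compact_EVT_min X_nonempty
  (bounded_closed_compact X_bounded X_closed) (@within_inner_psi_continuous p).
exists z; split=> [|z' Xz']; first by rewrite inE in Xz.
by apply: hz; rewrite inE.
Qed.

(** A negative directional derivative towards [z] would let a short step along the segment, which
    stays in [X] by convexity, decrease the objective. *)
Lemma argmin_first_order p y z :
  argmin p y -> X z -> 0 <= inner (p + dpsi y) (z - y).
Proof.
move=> [Xy miny] Xz; rewrite leNgt; apply/negP => g0.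
(* With this [e] the remainder after a step [h] is at most half of the first-order decrease
   [- g * h]; below, [h] is capped by [1] to stay on the segment and by a multiple of [d] to stay in
   the ball. *)
set g := inner _ _ in g0; pose e := - g / (2 * (`|z - y| + 1)).
have m0 : 0 < `|z - y| + 1 by rewrite ltr_wpDl.
have e0 : 0 < e by rewrite divr_gt0 ?oppr_gt0// mulr_gt0.
have [d /= d0 hd] := (nbhs_ballP _ _).1 (psi_C1.1 y Xy e e0).
pose h := Num.min 1 (d / (2 * (`|z - y| + 1))).
have h0 : 0 < h by rewrite lt_min ltr01 divr_gt0// mulr_gt0.
have h1 : h <= 1 by rewrite ge_min lexx.
pose w := y + h *: (z - y).
have Xw : X w by apply: convex_set_segment => //; exact: ltW.
have wy : w - y = h *: (z - y) by rewrite /w addrC addKr.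
have hm : h * `|z - y| < d.
  have hd2 : h <= d / (2 * (`|z - y| + 1)) by rewrite ge_min lexx orbT.
  move: hd2; rewrite ler_pdivlMr ?mulr_gt0// => hd2.
  have : 0 <= h * `|z - y| by rewrite mulr_ge0// ltW.
  lra.
have Bw : ball y d w.
  by rewrite -ball_normE /ball_/= distrC wy normrZ gtr0_norm.
have := hd w Bw Xw; rewrite wy normrZ innerZr (gtr0_norm h0) => /ler_normlW hr.
have wE : inner p w = inner p y + h * inner p (z - y) by rewrite /w innerDr innerZr.
have := miny w Xw; rewrite wE => hmin.
have e1 : e * (h * `|z - y|) <= - g * h / 2.
  rewrite /e -[leLHS]mulrA -[leRHS]mulrA.
  rewrite ler_pM2l ?oppr_gt0// mulrCA ler_pM2l//.
  by rewrite mulrC ler_pdivrMr ?mulr_gt0//; lra.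
have : g * h < 0 by rewrite nmulr_rlt0.
move: hmin e1 hr; rewrite /g innerDl; lra.
Qed.

(** First-order optimality, rewritten with the three-point identity of Bregman divergences. *)
Lemma argmin_three_point q x y z : argmin (q - dpsi x) y ->
  X z -> inner q (y - z) <= B z x - B z y - B y x.
Proof.
move=> hy Xz; have := argmin_first_order hy Xz.
by rewrite /bregman !innerE; lra.
Qed.

(** Strong convexity in both directions makes [dpsi] strongly monotone; it is combined with the two
    optimality conditions, each tested at the other minimiser. The case [p = q] gives uniqueness,
    the general case Lipschitz dependence on [p]. *)
Lemma argmin_dist p q y z : argmin p y -> argmin q z ->
  alpha * nrm (y - z) ^+ 2 <= inner (q - p) (y - z).
Proof.
move=> hy hz; have [Xy _] := hy; have [Xz _] := hz.
have := argmin_first_order hy Xz.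
have := argmin_first_order hz Xy.
have := bregman_ge Xy Xz; have := bregman_ge Xz Xy.
rewrite -(nrmN hnrm (z - y)) opprB /bregman !innerE; lra.
Qed.

(** Minimisers exist by compactness and are unique by strong convexity, so the choice made by [get]
    is canonical; a function is what lets measurability pass through the iteration. *)
Definition prox p : 'rV[R]_n := get (fun z => argmin p z).

Lemma prox_argmin p : argmin p (prox p).
Proof. by have [z hz] := argmin_exists p; exact: getI hz. Qed.

Lemma argminE p y : argmin p y -> y = prox p.
Proof.
move=> hy; have := argmin_dist hy (prox_argmin p).
rewrite subrr -(scale0r 0) innerZl mul0r => h.
apply/eqP; rewrite -subr_eq0; apply/eqP/(nrm0_eq0 hnrm)/eqP.
rewrite -sqrf_eq0 eq_le sqr_ge0 andbT.
by rewrite -(pmulr_rle0 _ alpha_gt0).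
Qed.

Lemma prox_continuous : continuous prox.
Proof.
have [C C0 hC] := normr_le_nrm hnrm.
apply: (@dist_le_continuous _ _ _ (C ^+ 2 * n%:R / alpha)) => p q.
have := argmin_dist (prox_argmin p) (prox_argmin q).
set v := prox p - prox q => h1.
have h2 : alpha * nrm v ^+ 2 <= n%:R * (`|p - q| * `|v|).
  apply: le_trans h1 _; rewrite (distrC p).
  exact: le_trans (ler_norm _) (normr_inner_le _ _).
have h3 : `|v| ^+ 2 <= C ^+ 2 * nrm v ^+ 2.
  by rewrite -exprMn lerXn2r ?hC ?nnegrE ?mulr_ge0 ?(nrm_ge0 hnrm).
have [->|v0] := eqVneq `|v| 0; 
  first by rewrite !mulr_ge0 ?invr_ge0 ?exprn_ge0 ?(ltW alpha_gt0).
have vp : 0 < `|v| by rewrite lt_neqAle eq_sym v0 normr_ge0.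
rewrite -(ler_pM2r vp) -expr2; apply: le_trans h3 _.
have h4 : nrm v ^+ 2 <= alpha^-1 * (n%:R * (`|p - q| * `|v|)).
  by rewrite ler_pdivlMl.
by apply: le_trans (ler_wpM2l (exprn_ge0 2 C0) h4) _; lra.
Qed.

(** Here [q] and [q'] stand for two consecutive samples and [e] for the noise of [q'], so that
    [q' - e] is the operator at [y]. The last term is the only one linear in the noise, and it does
    not involve [z]. *)
Lemma popov_step g q q' e x x' y u u' z : X x -> X u ->
  argmin (g *: q - dpsi x) y -> argmin (g *: q' - dpsi x) x' ->
  argmin (- (g *: e) - dpsi u) u' -> X z ->
  g * inner (q' - e) (y - z) <=
    (B z x - B z x') + (B z u - B z u')
    + g ^+ 2 / (2 * alpha) * (conj_norm nrm (q' - q) ^+ 2 + conj_norm nrm e ^+ 2)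
    - g * inner e (y - u).
Proof.
move=> Xx Xu hy hx' hu' Xz; have [Xy _] := hy; have [Xx' _] := hx'.
have [Xu' _] := hu'.
(* [h1] tests the first prox step at the result [x'] of the second; [h2] and [h3] test [x'] and [u']
   at [z]. The squared distances from Young's inequality ([h4], [h5]) are absorbed by the
   divergences of [x'] from [y] ([h6]) and of [u'] from [u] ([h7]). *)
have h1 := argmin_three_point hy Xx'.
have h2 := argmin_three_point hx' Xz.
have h3 := argmin_three_point hu' Xz.
have h4 := inner_young hnrm g (q' - q) (y - x') alpha_gt0.
have h5 := inner_young hnrm g e (u' - u) alpha_gt0.
have h6 := bregman_ge Xy Xx'.
have h7 := bregman_ge Xu Xu'.
have h8 := bregman_ge0 Xx Xy.
move: h6; rewrite -(nrmN hnrm (x' - y)) opprB => h6.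
move: h1 h2 h3 h4 h5; rewrite !innerE; lra.
Qed.

End Prox.

(** * Borel measurability of vector-valued maps *)

Section BorelVec.
Context {R : realType} {n : nat}.
Local Notation V := 'rV[R]_n.
Local Notation bV := (borelV R n).

Lemma borelV_open (U : set V) : open U -> measurable (U : set bV).
Proof. exact: sub_sigma_algebra. Qed.

Lemma borelV_closed (U : set V) : closed U -> measurable (U : set bV).
Proof.
by move=> /closed_openC /borelV_open mU; rewrite -(setCK U); exact: measurableC.
Qed.

(** Open sets of the subspace are traces of open sets of the whole space, and [X] is Borel because
    it is closed. *)
Lemma within_continuous_borelV (X : set V) (f : V -> V) : closed X ->
  {within X, continuous f} -> measurable_fun (X : set bV) (f : bV -> bV).
Proof.
move=> cX cf; apply: (@measurability _ _ _ bV _ _ (@open V)) => // _ [U oU <-].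
have /open_subspaceP[W oW WX] : open (f @^-1` U : set (subspace X)).
  by move/continuousP : cf; exact.
rewrite setIC -WX.
by apply: measurableI; [exact: borelV_open|exact: borelV_closed].
Qed.

Lemma continuous_borelV (f : V -> V) : continuous f ->
  measurable_fun setT (f : bV -> bV).
Proof.
move=> cf; apply: within_continuous_borelV; first exact: closedT.
exact: continuous_subspaceT.
Qed.

Lemma measurable_coord i :
  measurable_fun (setT : set bV) (fun v : bV => (v : V) ord0 i).
Proof.
apply: (@measurability _ _ bV _ _ _ (@RGenOpens.G R)).
  exact: RGenOpens.measurableE.
move=> _ [_ [a [b ->]] <-]; rewrite setTI; apply: borelV_open.
apply: (@open_comp _ _ (fun v : V => v ord0 i)) => [v _|].
  exact: coord_continuous.
exact: interval_open.
Qed.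

(** Every open set is a countable union of boxes with rational centre and radius [1 / (k + 1)], and
    the preimage of a box is a finite intersection of coordinate preimages. *)
Lemma measurable_rowP d (T : measurableType d) (D : set T) (f : T -> bV) :
  (forall i, measurable_fun D (fun w => (f w : V) ord0 i)) -> measurable_fun D f.
Proof.
move=> mf mD.
pose box (p : 'rV[rat]_n * nat) : set V :=
  [set v | forall i, `|v ord0 i - ratr (p.1 ord0 i)| < p.2.+1%:R^-1].
have mbox p : measurable (D `&` f @^-1` box p).
  have -> : D `&` f @^-1` box p = D `&` \bigcap_(i in [set: 'I_n])
      (D `&` (fun w => (f w : V) ord0 i) @^-1` ball (ratr (p.1 ord0 i) : R) p.2.+1%:R^-1).
    apply/seteqP; split=> w /= [Dw bw]; split=> // i.
      by move=> _; split=> //; rewrite /ball/= distrC; exact: bw.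
    by have [_] := bw i Logic.I; rewrite /ball/= distrC.
  apply: measurableI => //; apply: fin_bigcap_measurable => // i _.
  by apply: mf => //; exact: measurable_ball.
apply: (@measurability _ _ _ bV _ _ (@open V)) => // _ [U oU <-].
have -> : D `&` f @^-1` U = \bigcup_(p : 'rV[rat]_n * nat)
    (if `[< box p `<=` U >] then D `&` f @^-1` box p else set0).
  apply/seteqP; split=> [w /= [Dw Uw]|w [p _]]; last first.
    by case: asboolP => // bU [Dw bw]; split=> //; exact: bU.
  have [e /= e0 he] := (nbhs_ballP _ _).1 (open_nbhs_nbhs (conj oU Uw)).
  (* A box of radius below [e / 2] that contains [f w] lies in the [e]-ball around [f w]. *)
  have [k hk] : exists k : nat, k.+1%:R^-1 < e / 2.
    have e2 : 0 < e / 2 by rewrite divr_gt0.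
    by have [k _ hk] := near_infty_natSinv_lt (PosNum e2); exists k; exact: hk k (leqnn k).
  have kp : 0 < k.+1%:R^-1 :> R by rewrite invr_gt0.
  have hq i : exists q : rat, `|(f w : V) ord0 i - ratr q| < k.+1%:R^-1.
    have [|q] := @rat_in_itvoo R ((f w : V) ord0 i) ((f w : V) ord0 i + k.+1%:R^-1).
      by rewrite ltrDl.
    rewrite in_itv/= => /andP[q1 q2]; exists q.
    by rewrite distrC ger0_norm ?subr_ge0 ?ltW// ltrBlDl.
  have [q hq'] := choice hq.
  exists (\row_i q i, k) => //=; case: asboolP => [_|[]]; last first.
    move=> v bv; apply: he; split=> // i0 i; rewrite !ord1.
    have := bv i; have := hq' i; rewrite /ball/= mxE => h1 h2.
    rewrite -(subrKA (ratr (q i) : R)); apply: le_lt_trans (ler_normD _ _) _.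
    by rewrite [X in _ + X]distrC (splitr e) ltrD// (lt_trans _ hk).
  by split=> // i /=; rewrite mxE.
apply: countable_bigcupT_measurable => [|p]; first exact: countableP.
by case: asboolP.
Qed.

Lemma measurable_coord_comp d (T : measurableType d) (D : set T) (f : T -> bV) i :
  measurable_fun D f -> measurable_fun D (fun w => (f w : V) ord0 i).
Proof. by move=> mf; apply: measurableT_comp (measurable_coord i) mf. Qed.

Lemma measurable_vecD d (T : measurableType d) (f g : T -> bV) :
  measurable_fun setT f -> measurable_fun setT g ->
  measurable_fun setT ((fun w => (f w : V) + (g w : V)) : T -> bV).
Proof.
move=> mf mg; apply: measurable_rowP => i.
rewrite (_ : (fun w => _) = (fun w => (f w : V) ord0 i + (g w : V) ord0 i)).
  by apply: measurable_funD; exact: measurable_coord_comp.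
by apply/funext => w; rewrite mxE.
Qed.

Lemma measurable_vecZ d (T : measurableType d) (k : R) (f : T -> bV) :
  measurable_fun setT f -> measurable_fun setT ((fun w => k *: (f w : V)) : T -> bV).
Proof.
move=> mf; apply: measurable_rowP => i.
rewrite (_ : (fun w => _) = (fun w => k * (f w : V) ord0 i)).
  by apply: measurable_funM => //; exact: measurable_coord_comp.
by apply/funext => w; rewrite mxE.
Qed.

Lemma measurable_vecN d (T : measurableType d) (f : T -> bV) :
  measurable_fun setT f -> measurable_fun setT ((fun w => - (f w : V)) : T -> bV).
Proof.
move=> mf; rewrite (_ : (fun w => _) = (fun w => (-1) *: (f w : V))).
  exact: measurable_vecZ.
by apply/funext => w; rewrite scaleN1r.
Qed.

Lemma measurable_vecB d (T : measurableType d) (f g : T -> bV) :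
  measurable_fun setT f -> measurable_fun setT g ->
  measurable_fun setT ((fun w => (f w : V) - (g w : V)) : T -> bV).
Proof. by move=> mf /measurable_vecN; exact: measurable_vecD. Qed.

End BorelVec.

(** * Weighted telescoping and sums of powers *)

Section WeightedSums.
Context {R : realType}.

(** Summation by parts: the increments of the nondecreasing weights multiply values of [b] that are
    at most [D], and these increments telescope. *)
Lemma telescope_weighted_le (r b : nat -> R) (D : R) N :
  0 <= r 0%N -> (forall t, r t <= r t.+1) -> (forall t, 0 <= b t <= D) ->
  \sum_(0 <= t < N.+1) r t * (b t - b t.+1) <= r N * D.
Proof.
move=> r0 rmono bD.
have rp t : 0 <= r t by elim: t => // t IH; exact: le_trans (rmono t).
(* The boundary term is kept so that the induction closes. *)
suff : \sum_(0 <= t < N.+1) r t * (b t - b t.+1) <= r N * D - r N * b N.+1.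
  by move/le_trans; apply; rewrite gerBl mulr_ge0//; case/andP: (bD N.+1).
elim: N => [|N IH].
  rewrite big_nat1 mulrBr lerD2r ler_wpM2l//; by case/andP: (bD 0%N).
rewrite big_nat_recr//=; apply: le_trans (lerD IH (lexx _)) _.
have : 0 <= (r N.+1 - r N) * (D - b N.+1).
  by rewrite mulr_ge0// subr_ge0//; case/andP: (bD N.+1).
lra.
Qed.

(** The left side is the integral of [s ^ a] from [0] to [m]. The induction step is the tangent
    inequality at [m + 1] for the convex function [s ^ (1 + a)], derived from Young's inequality. *)
Lemma powR_sum_ge (a : R) m : 0 < a ->
  m%:R `^ (1 + a) / (1 + a) <= \sum_(0 <= t < m) t.+1%:R `^ a.
Proof.
move=> a0; have a1 : 0 < 1 + a by lra.
elim: m => [|m IH]; first by rewrite big_nil powR0 ?gt_eqF// mul0r.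
rewrite big_nat_recr//=; apply: le_trans (lerD IH (lexx _)).
have M0 : (0:R) <= m%:R by [].
have M1 : (0:R) < m.+1%:R by [].
(* Young's inequality with exponents [1 + a] and [(1 + a) / a], applied to [m] and
   [(m + 1) ^ a] *)
have := @conjugate_powR R m%:R (m.+1%:R `^ a) (1 + a) ((1 + a) / a) M0 (powR_ge0 _ _).
move=> /(_ a1 (divr_gt0 a1 a0)).
have -> : (1 + a)^-1 + ((1 + a) / a)^-1 = 1 by field; rewrite !gt_eqF.
move=> /(_ erefl).
rewrite -powRrM mulrCA divff ?gt_eqF// mulr1.
have E : m.+1%:R `^ (1 + a) = m.+1%:R * m.+1%:R `^ a :> R.
  by rewrite powRD ?powRr1// (gt_eqF M1) implybT.
rewrite E; set p := m.+1%:R `^ a; set s := m%:R `^ (1 + a).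
rewrite -natr1 invf_div => h.
rewrite ler_pdivrMr// [leRHS]mulrDl divfK ?gt_eqF//.
have := ler_wpM2r (ltW a1) h.
rewrite [leRHS]mulrDl divfK ?gt_eqF//.
have -> : (m%:R + 1) * p * (a / (1 + a)) * (1 + a) = (m%:R + 1) * p * a.
  by field; rewrite gt_eqF.
lra.
Qed.

End WeightedSums.

(** * Pathwise bound on the dual gap *)

Section Gap.
Context {R : realType} {n : nat}.
Variables (nrm : 'rV[R]_n -> R) (hnrm : is_norm nrm).
Variables (X : set 'rV[R]_n) (X_convex : convex_set X).
Variables (alpha : R) (alpha_gt0 : 0 < alpha).
Variables (psi : 'rV[R]_n -> R) (dpsi : 'rV[R]_n -> 'rV[R]_n).
Hypotheses (psi_C1 : C1_on X psi dpsi)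
  (psi_sc : strongly_convex_on nrm X alpha psi dpsi).
Variables (F : 'rV[R]_n -> 'rV[R]_n) (F_monotone : monotone_on X F).
Variables (gamma : nat -> R) (gamma_gt0 : forall t, 0 < gamma t)
  (gamma_decr : forall t, gamma t.+1 <= gamma t).
Variable D : R.
Hypothesis D_bound : forall x z, X x -> X z -> bregman psi dpsi z x <= D.

Local Notation argmin p := (is_argmin X (fun z => inner p z + psi z)).
Local Notation B := (bregman psi dpsi).

(** Each new index moves the average towards the new point by the share of the new weight in the
    total, hence along a segment of [X]. *)
Lemma weighted_average_in (y : nat -> 'rV[R]_n) N :
  (forall t, X (y t)) -> X (weighted_average gamma N y).
Proof.
move=> Xy; rewrite /weighted_average.
elim: N => [|N IH].
  by rewrite !big_nat1 scalerA mulVf ?scale1r// invr_eq0 gt_eqF.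
rewrite (big_nat_recr N.+1)//= (big_nat_recr N.+1)//=.
set S := \sum_(0 <= t < N.+1) (gamma t)^-1 in IH *.
set V := \sum_(0 <= t < N.+1) (gamma t)^-1 *: y t.+1 in IH *.
have gp : 0 < (gamma N.+1)^-1 by rewrite invr_gt0.
have Sp : 0 < S.
  rewrite /S big_nat_recr//= ltr_wpDl ?invr_gt0//.
  by apply: sumr_ge0 => i _; rewrite invr_ge0 ltW.
have T0 : 0 < S + (gamma N.+1)^-1 by rewrite addr_gt0.
have := @convex_set_segment _ _ _ _ (y N.+2)
  ((gamma N.+1)^-1 / (S + (gamma N.+1)^-1)) X_convex IH (Xy _).
rewrite divr_ge0 ?(ltW gp) ?(ltW T0)// ler_pdivrMr// mul1r lerDr (ltW Sp).
move=> /(_ isT isT); congr X.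
apply/rowP => i; rewrite !mxE; field.
by rewrite !gt_eqF// addr_gt0// mulr_gt0.
Qed.

(** For a fixed outcome, monotonicity replaces [F z] by [F (y t.+1)], and [popov_step] is divided by
    [gamma t ^+ 2] and summed. The resulting bound is free of [z], so it survives the supremum. *)
Lemma popov_gap_bound (x y u q e : nat -> 'rV[R]_n) (K : R) N :
  0 <= K -> X (x 0%N) -> X (u 0%N) -> X (y 0%N) ->
  (forall t, argmin (gamma t *: q t - dpsi (x t)) (y t.+1)) ->
  (forall t, argmin (gamma t *: q t.+1 - dpsi (x t)) (x t.+1)) ->
  (forall t, argmin (- (gamma t *: e t.+1) - dpsi (u t)) (u t.+1)) ->
  (forall t, F (y t) = q t - e t) ->
  (forall t, conj_norm nrm (F (y t.+1) - F (y t)) <= K) ->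
  (dual_gap X F (weighted_average gamma N y) <=
    ((\sum_(0 <= t < N.+1) (gamma t)^-1)^-1 *
     (2 * ((gamma N)^-1 ^+ 2 * D) + \sum_(0 <= t < N.+1)
       ((2 * alpha)^-1 * (2 * K ^+ 2 + 5 * conj_norm nrm (e t.+1) ^+ 2
                          + 4 * conj_norm nrm (e t) ^+ 2)
        - (gamma t)^-1 * inner (e t.+1) (y t.+1 - u t))))%:E)%E.
Proof.
move=> K0 Xx0 Xu0 Xy0 hy hx hu Fy hK.
have Xx t : X (x t) by case: t => // t; case: (hx t).
have Xu t : X (u t) by case: t => // t; case: (hu t).
have Xy t : X (y t) by case: t => // t; case: (hy t).
set S := \sum_(0 <= t < N.+1) _.
have Sp : 0 < S.
  rewrite /S big_nat_recr//= ltr_wpDl ?invr_gt0//.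
  by apply: sumr_ge0 => i _; rewrite invr_ge0 ltW.
apply: ge_ereal_sup => _ [z Xz <-]; rewrite lee_fin.
have -> : inner (F z) (weighted_average gamma N y - z) =
    S^-1 * \sum_(0 <= t < N.+1) (gamma t)^-1 * inner (F z) (y t.+1 - z).
  have -> : weighted_average gamma N y - z =
      S^-1 *: \sum_(0 <= t < N.+1) (gamma t)^-1 *: (y t.+1 - z).
    under [in RHS]eq_bigr do rewrite scalerBr.
    rewrite sumrB scalerBr -scaler_suml -/S scalerA mulVf ?gt_eqF// scale1r.
    by [].
  rewrite innerZr inner_sumr; congr (_ * _).
  by apply: eq_bigr => t _; rewrite innerZr.
rewrite ler_wpM2l ?invr_ge0 ?(ltW Sp)//.
pose r t := (gamma t)^-1 ^+ 2.
have rmono t : r t <= r t.+1.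
  by rewrite /r lerXn2r ?nnegrE ?invr_ge0 ?(ltW (gamma_gt0 _))// lef_pV2 ?posrE.
have bD (v : nat -> 'rV[R]_n) : (forall t, X (v t)) -> forall t, 0 <= B z (v t) <= D.
  move=> Xv t; rewrite D_bound// andbT.
  exact: (bregman_ge0 alpha_gt0 psi_sc).
have T1 := telescope_weighted_le N (sqr_ge0 _) rmono (bD x Xx).
have T2 := telescope_weighted_le N (sqr_ge0 _) rmono (bD u Xu).
rewrite /= in T1 T2; rewrite -/(r N).
apply: (@le_trans _ _ (\sum_(0 <= t < N.+1)
   (r t * (B z (x t) - B z (x t.+1)) + r t * (B z (u t) - B z (u t.+1)) +
    ((2 * alpha)^-1 * (2 * K ^+ 2 + 5 * conj_norm nrm (e t.+1) ^+ 2
                          + 4 * conj_norm nrm (e t) ^+ 2)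
        - (gamma t)^-1 * inner (e t.+1) (y t.+1 - u t))))); last first.
  by rewrite big_split lerD2r big_split/=; lra.
apply: ler_sum_nat => t _.
have g0 := gamma_gt0 t.
have h1 : inner (F z) (y t.+1 - z) <= inner (q t.+1 - e t.+1) (y t.+1 - z).
  by rewrite -Fy -subr_ge0 -innerBl; exact: F_monotone.
have h2 := popov_step hnrm X_convex alpha_gt0 psi_C1 psi_sc (Xx t) (Xu t)
  (hy t) (hx t) (hu t) Xz.
(* From [(K + (c + c')) ^ 2 <= 2 K ^ 2 + 4 c ^ 2 + 4 c' ^ 2]. The coefficient [5] in the goal is
   this [4] plus the square of [e t.+1] already present in [popov_step]. *)
have h3 : conj_norm nrm (q t.+1 - q t) ^+ 2 <=
    2 * K ^+ 2 + 4 * conj_norm nrm (e t.+1) ^+ 2 + 4 * conj_norm nrm (e t) ^+ 2.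
  have -> : q t.+1 - q t = (F (y t.+1) - F (y t)) + (e t.+1 - e t).
    by rewrite !Fy; apply/rowP => i; rewrite !mxE; ring.
  have n1 := conj_normD hnrm (F (y t.+1) - F (y t)) (e t.+1 - e t).
  have n2 := conj_normD hnrm (e t.+1) (- e t).
  rewrite (conj_normN hnrm) in n2.
  have n3 := conj_norm_ge0 hnrm (F (y t.+1) - F (y t) + (e t.+1 - e t)).
  have n4 := conj_norm_ge0 hnrm (e t.+1); have n5 := conj_norm_ge0 hnrm (e t).
  have n6 := hK t.
  set c := conj_norm nrm (e t.+1) in n2 n4 *.
  set c' := conj_norm nrm (e t) in n2 n5 *.
  apply: (@le_trans _ _ ((K + (c + c')) ^+ 2)).
    by rewrite lerXn2r ?nnegrE//; lra.
  have := sqr_ge0 (K - (c + c')); have := sqr_ge0 (c - c').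
  by rewrite !expr2; lra.
apply: (@le_trans _ _ (r t * (gamma t * inner (q t.+1 - e t.+1) (y t.+1 - z)))).
  rewrite /r expr2 -mulrA (mulrA _ (gamma t)) mulVf ?gt_eqF// mul1r.
  by rewrite ler_wpM2l// invr_ge0 ltW.
apply: le_trans (ler_wpM2l (sqr_ge0 _) h2) _; rewrite -/(r t).
have -> : (gamma t)^-1 = r t * gamma t.
  by rewrite /r expr2 -mulrA mulVf ?gt_eqF// mulr1.
(* The division cancels the step size in front of the squared terms. *)
have rg : r t * (gamma t ^+ 2 / (2 * alpha)) = (2 * alpha)^-1.
  by rewrite /r; field; rewrite !gt_eqF.
have a2 : 0 <= (2 * alpha)^-1 by rewrite invr_ge0 mulr_ge0// ltW.
have := ler_wpM2l a2 h3.
set G := gamma t ^+ 2 / (2 * alpha) in rg *; rewrite -{}rg; move: (r t) @G => r' G.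
lra.
Qed.

End Gap.

(** * Integrals of real-valued functions under a probability measure *)

Section RealIntegrable.
Context d (T : measurableType d) {R : realType} (P : probability T R).
Local Notation int f := (P.-integrable setT (EFin \o f)).

Lemma integrable_cst_real (k : R) : int (fun=> k).
Proof. exact: finite_measure_integrable_cst. Qed.

Lemma integrableZ_real (k : R) (f : T -> R) : int f -> int (fun w => k * f w).
Proof. by move=> fi; exact: (integrableZl measurableT k fi). Qed.

Lemma integrableD_real (f g : T -> R) : int f -> int g -> int (fun w => f w + g w).
Proof. by move=> fi gi; exact: (integrableD measurableT fi gi). Qed.

Lemma integrableB_real (f g : T -> R) : int f -> int g -> int (fun w => f w - g w).
Proof. by move=> fi gi; exact: (integrableB measurableT fi gi). Qed.

Lemma integrable_sum_real I (s : seq I) (f : I -> T -> R) :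
  (forall i, int (f i)) -> int (fun w => \sum_(i <- s) f i w).
Proof.
move=> fi; rewrite (_ : _ \o _ = fun w => (\sum_(i <- s) (f i w)%:E)%E).
  by apply: integrable_sum => // i _; exact: fi.
by apply/funext => w; rewrite /= sumEFin.
Qed.

Lemma Rintegral_sum I (s : seq I) (f : I -> T -> R) :
  (forall i, int (f i)) ->
  \int[P]_w (\sum_(i <- s) f i w) = \sum_(i <- s) \int[P]_w f i w.
Proof.
move=> fi; elim: s => [|i s IH].
  by rewrite big_nil; under eq_Rintegral do rewrite big_nil; rewrite Rintegral_cst// mul0r.
rewrite big_cons -IH -RintegralD//; last exact: integrable_sum_real.
by apply: eq_Rintegral => w _; rewrite big_cons.
Qed.

Lemma Rintegral_cst_prob (k : R) : \int[P]_w k = k.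
Proof.
rewrite Rintegral_cst// -[RHS]mulr1; congr (_ * _).
exact: (congr1 (@fine R) (probability_setT P)).
Qed.

End RealIntegrable.

(** * Orthogonality to a sub-sigma-algebra *)

Section SubSigma.
Context d (T : measurableType d) {R : realType} (P : probability T R).
Variables (S : set (set T)) (S_sub : <<s S >> `<=` @measurable _ T).
Local Notation TS := (g_sigma_algebraType S).

Lemma measurable_fun_sub_sigma d' (U : measurableType d') (S' : set (set T))
    (f : T -> U) : S `<=` <<s S' >> ->
  measurable_fun (setT : set TS) f ->
  measurable_fun (setT : set (g_sigma_algebraType S')) f.
Proof.
move=> SS mf _ A mA; rewrite setTI.
have := mf measurableT A mA; rewrite setTI; move: (f @^-1` A).
apply: smallest_sub => //; exact: smallest_sigma_algebra.
Qed.

Lemma measurable_fun_from_sub d' (U : measurableType d') (f : T -> U) :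
  measurable_fun (setT : set TS) f -> measurable_fun (setT : set T) f.
Proof. by move=> mf _ A mA; apply: S_sub; exact: mf. Qed.

Lemma Rintegral_mul_indic (f : T -> R) (A : set T) :
  \int[P]_w (f w * \1_A w) = \int[P]_(w in A) f w.
Proof.
rewrite [RHS]Rintegral_mkcond; congr Rintegral; apply/funext => w.
by rewrite /patch indicE; case: ifP; rewrite ?mulr1 ?mulr0.
Qed.

Variable f : T -> R.
Hypotheses (f_int : P.-integrable setT (EFin \o f))
  (f_null : forall A, <<s S >> A -> \int[P]_(w in A) f w = 0).

Lemma integrable_mul_bounded (h : T -> R) (C : R) :
  measurable_fun (setT : set T) h -> (forall w, `|h w| <= C) ->
  P.-integrable setT (EFin \o (fun w => f w * h w)).
Proof.
move=> mh hC; apply: (@integrableMl _ _ _ _ _ _ _ h f_int) => //.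
exists C; split; first exact: num_real.
by move=> M CM w _; exact: le_trans (hC w) (ltW CM).
Qed.

(* Subtracting [C / 2] times the sign of [h] halves the bound on [h] without changing
   the integral. *)
Lemma Rintegral_mul_halving (h : T -> R) (C : R) j :
  measurable_fun (setT : set TS) h -> (forall w, `|h w| <= C) ->
  `|\int[P]_w (f w * h w)| <= C / 2 ^+ j * \int[P]_w `|f w|.
Proof.
elim: j h C => [|j IH] h C mh hC.
  have mhT := measurable_fun_from_sub mh.
  have ih := integrable_mul_bounded mhT hC.
  rewrite expr0 divr1; apply: le_trans (le_normr_Rintegral _ ih) _ => //.
  rewrite -RintegralZl//; last exact: integrable_norm.
  apply: le_Rintegral => //; first exact: integrable_norm.
    exact/integrableZ_real/integrable_norm.
  by move=> w _; rewrite normrM mulrC ler_wpM2r.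
pose A : set T := h @^-1` `[0, +oo[%classic.
have SA : <<s S >> A.
  by have := mh measurableT `[0, +oo[%classic (measurable_itv _); rewrite setTI.
pose h1 w := h w - (C * \1_A w - C / 2).
have C0 : 0 <= C by exact: le_trans (hC point).
have mA : measurable (A : set TS) by [].
have m1 : measurable_fun (setT : set TS) (\1_A : T -> R) by exact: measurable_indic.
have mh1 : measurable_fun (setT : set TS) h1.
  by apply: measurable_funB => //; apply: measurable_funB => //; apply: measurable_funM.
have h1C w : `|h1 w| <= C / 2.
  have := hC w; rewrite /h1 !ler_norml indicE.
  have [wA|wA] := boolP (w \in A); rewrite /= ?mulr1 ?mulr0.
    have : 0 <= h w by move: wA; rewrite inE /A/= in_itv/= andbT.
    by move=> h0 /andP[_ hc]; apply/andP; split; lra.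
  have : h w < 0.
    by move: wA; rewrite notin_setE /A/= in_itv/= andbT => /negP; rewrite -ltNge.
  by move=> h0 /andP[hc _]; apply/andP; split; lra.
have mh1T := measurable_fun_from_sub mh1.
have i1 := integrable_mul_bounded mh1T h1C.
have ind1 w : `|(\1_A w : R)| <= 1 by rewrite indicE; case: (_ \in _); rewrite ?normr1 ?normr0.
have i2 := integrable_mul_bounded (measurable_fun_from_sub m1) ind1.
(* The two correction terms integrate [f] over [A] and over the whole space; both vanish by
   [f_null]. *)
have -> : \int[P]_w (f w * h w) = \int[P]_w (f w * h1 w).
  rewrite (_ : (fun w => f w * h w) =
      (fun w => f w * h1 w + (C * (f w * \1_A w) - C / 2 * f w))).
    rewrite RintegralD//; last first.
      by apply: integrableB_real; exact: integrableZ_real.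
    rewrite RintegralB//; [|exact: integrableZ_real|exact: integrableZ_real].
    rewrite !RintegralZl// Rintegral_mul_indic f_null// f_null ?mulr0 ?subr0 ?addr0//.
    exact: (@measurableT _ TS).
  by apply/funext => w; rewrite /h1; ring.
apply: le_trans (IH _ _ mh1 h1C) _.
by rewrite exprS invfM mulrA.
Qed.

(** The bounds of [Rintegral_mul_halving] tend to zero as [j] grows. *)
Lemma Rintegral_mul_orthogonal (h : T -> R) (C : R) :
  measurable_fun (setT : set TS) h -> (forall w, `|h w| <= C) ->
  \int[P]_w (f w * h w) = 0.
Proof.
move=> mh hC; apply/eqP; rewrite -normr_le0.
have K0 : 0 <= C * \int[P]_w `|f w|.
  by rewrite mulr_ge0 ?Rintegral_ge0//; exact: le_trans (hC point).
set K := C * _ in K0; apply/ler_addgt0Pr => e e0; rewrite add0r.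
(* This [j] satisfies [K / e < j], and [j < 2 ^ j]. *)
have := archi_boundP (divr_ge0 K0 (ltW e0)); set j := Num.bound _ => hj.
apply: le_trans (Rintegral_mul_halving j mh hC) _.
rewrite mulrAC -/K ler_pdivrMr ?exprn_gt0// mulrC -ler_pdivrMr//.
apply: le_trans (ltW hj) _; rewrite -natrX ler_nat.
by apply: ltnW; exact: ltn_expl.
Qed.

End SubSigma.

(** * Comparison of integrals almost everywhere *)

Section AlmostEverywhere.
Context d (T : measurableType d) {R : realType} (P : probability T R).

Lemma Rintegral_ae_ge0 (f : T -> R) : P.-integrable setT (EFin \o f) ->
  {ae P, forall w, 0 <= f w} -> 0 <= \int[P]_w f w.
Proof.
move=> fi f0; have -> : \int[P]_w f w = \int[P]_w `|f w|.
  congr fine; apply: ae_eq_integral => //.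
  - exact: measurable_int fi.
  - by apply: measurable_int (integrable_norm fi).
  - by apply: filterS f0 => w fw _ /=; rewrite ger0_norm.
exact: Rintegral_ge0.
Qed.

(* Unlike in [ge0_le_integral], [g] need not be measurable. *)
Lemma ge0_le_integral_ae (g : T -> \bar R) (f : T -> R) :
  (forall w, (0 <= g w)%E) -> P.-integrable setT (EFin \o f) ->
  {ae P, forall w, (g w <= (f w)%:E)%E} ->
  (\int[P]_w g w <= (\int[P]_w f w)%:E)%E.
Proof.
move=> g0 fi [N [mN PN gf]].
(* Raising [f] to [+oo] on the null set makes the inequality hold everywhere and keeps the
   integral. *)
pose f' w : \bar R := if w \in N then +oo%E else (f w)%:E.
have gf' w : (g w <= f' w)%E.
  rewrite /f'; case: ifPn => [_|wN]; first exact: leey.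
  by apply: contrapT => h; move: wN; rewrite notin_setE; apply; exact: gf.
have mf' : measurable_fun setT f'.
  apply: measurable_fun_ifT => //; last exact: measurable_int fi.
  apply: (measurable_fun_bool true).
  rewrite (_ : _ @^-1` _ = N) ?setTI//.
  by apply/seteqP; split=> w /=; [move/set_mem|move/mem_set].
have -> : (\int[P]_w f w)%:E = (\int[P]_w f' w)%E.
  rewrite fineK ?integrable_fin_num//; apply: ae_eq_integral => //.
    exact: measurable_int fi.
  exists N; split=> // w /=; apply: contra_notP => wN _.
  by rewrite /f' ifF//; apply/negbTE; rewrite notin_setE.
(* The integral of a nonnegative function is a supremum over the simple functions below it, hence
   monotone by inclusion. *)
rewrite !ge0_integralTE//; last by move=> w; exact: le_trans (gf' w).
by apply: le_ereal_sup => _ [h hg <-]; exists h => // w; exact: le_trans (hg w) _.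
Qed.

End AlmostEverywhere.

Lemma bounded_set_le {R : realType} {V : normedModType R} (X : set V) :
  bounded_set X -> exists C : R, forall x, X x -> `|x| <= C.
Proof.
by move=> [M [_ hM]]; exists (M + 1) => x Xx; apply: hM => //; rewrite ltrDl.
Qed.

(** * The information generated by the initial point and the samples *)

Section Filtration.
Context d d' (T : measurableType d) (Om : measurableType d') {R : realType}
  {n : nat} (P : probability T R).
Variables (x0 : {RV P >-> borelV R n}) (xis : nat -> {RV P >-> Om}).

(* [past x0 (fun s => xis s) t] is by definition [<<s past_gen t >>]. *)
Definition past_gen t : set (set T) :=
  preimage_set_system setT x0 measurable `|`
    \bigcup_(s in `I_t) preimage_set_system setT (xis s) measurable.

Lemma past_gen_sub t : <<s past_gen t >> `<=` @measurable _ T.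
Proof.
apply: smallest_sub; first exact: sigma_algebra_measurable.
move=> A [[B mB <-]|[s _ [B mB <-]]].
  exact: (@measurable_funPT _ _ _ _ x0).
exact: (@measurable_funPT _ _ _ _ (xis s)).
Qed.

Lemma past_gen_succ t : past_gen t `<=` <<s past_gen t.+1 >>.
Proof.
move=> A [hA|[s st hA]]; apply: sub_sigma_algebra; first by left.
by right; exists s => //=; exact: ltnW.
Qed.

Lemma past_x0 t :
  measurable_fun (setT : set (g_sigma_algebraType (past_gen t))) x0.
Proof. by move=> _ A mA; apply: sub_sigma_algebra; left; exists A. Qed.

Lemma past_xi t :
  measurable_fun (setT : set (g_sigma_algebraType (past_gen t.+1))) (xis t).
Proof.
by move=> _ A mA; apply: sub_sigma_algebra; right; exists t => /=; [|exists A].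
Qed.

End Filtration.

(** * Expected dual gap of the averaged iterates *)

Section PopovMean.
Context (R : realType) (n : nat)
  (nrm : 'rV[R]_n -> R) (hnrm : is_norm nrm)
  (X : set 'rV[R]_n) (X_nonempty : X !=set0) (X_closed : closed X)
  (X_convex : convex_set X) (X_bounded : bounded_set X)
  (alpha : R) (alpha_gt0 : 0 < alpha)
  (psi : 'rV[R]_n -> R) (dpsi : 'rV[R]_n -> 'rV[R]_n)
  (psi_C1 : C1_on X psi dpsi)
  (psi_sc : strongly_convex_on nrm X alpha psi dpsi)
  (d d' : measure_display) (T : measurableType d) (Om : measurableType d')
  (P : probability T R)
  (F : 'rV[R]_n -> 'rV[R]_n) (Fhat : 'rV[R]_n -> Om -> 'rV[R]_n)
  (Fhat_meas : jointly_measurable_on X Fhat)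
  (F_monotone : monotone_on X F)
  (gamma : nat -> R) (gamma_gt0 : forall t, 0 < gamma t)
  (gamma_decr : forall t, gamma t.+1 <= gamma t)
  (x0 : {RV P >-> borelV R n}) (x0_in : forall w, X (x0 w))
  (xis : nat -> {RV P >-> Om})
  (x y : nat -> T -> 'rV[R]_n)
  (alg : popov X psi dpsi Fhat gamma x0 (fun t => xis t) x y)
  (sigma : R)
  (sampling_iterates : forall t : nat,
     sampling_at P nrm Fhat F sigma (past x0 (fun s => xis s) t)
       (xis t) (y t))
  (D : R)
  (D_bound : forall x z, X x -> X z -> bregman psi dpsi z x <= D)
  (K : R) (K_ge0 : 0 <= K)
  (F_bound : forall x y, X x -> X y -> conj_norm nrm (F x - F y) <= K).

Local Notation bV := (borelV R n).
Local Notation past_gen := (past_gen x0 xis).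
Local Notation past_type t := (g_sigma_algebraType (past_gen t)).
Local Notation argmin p := (is_argmin X (fun z => inner p z + psi z)).

Let x_in t w : X (x t w).
Proof.
case: t => [|t]; first by have [-> _ _] := alg w.
by have [_ _ /(_ t)[_ []]] := alg w.
Qed.

Let y_in t w : X (y t w).
Proof.
case: t => [|t]; first by have [_ -> _] := alg w.
by have [_ _ /(_ t)[[]]] := alg w.
Qed.

Let y_argmin t w :
  argmin (gamma t *: Fhat (y t w) (xis t w) - dpsi (x t w)) (y t.+1 w).
Proof. by have [_ _ /(_ t)[]] := alg w. Qed.

Let x_argmin t w :
  argmin (gamma t *: Fhat (y t.+1 w) (xis t.+1 w) - dpsi (x t w)) (x t.+1 w).
Proof. by have [_ _ /(_ t)[]] := alg w. Qed.

Let prox_in p : X (prox X psi p).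
Proof.
by have [] := prox_argmin X_nonempty X_closed X_bounded psi_C1 p.
Qed.

Let measurable_prox d0 (T0 : measurableType d0) (p : T0 -> bV) :
  measurable_fun setT p ->
  measurable_fun setT ((fun w => prox X psi (p w)) : T0 -> bV).
Proof.
move=> mp; apply: (measurableT_comp (f := (prox X psi : bV -> bV))) mp.
apply: continuous_borelV; exact: (prox_continuous hnrm X_nonempty X_closed X_convex
  X_bounded alpha_gt0 psi_C1 psi_sc).
Qed.

Let measurable_dpsi d0 (T0 : measurableType d0) (p : T0 -> bV) :
  (forall w, X (p w)) -> measurable_fun setT p ->
  measurable_fun setT ((fun w => dpsi (p w)) : T0 -> bV).
Proof.
move=> Xp mp; apply: (@measurable_comp _ _ _ _ _ _ (X : set bV) (dpsi : bV -> bV)) mp.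
- exact: borelV_closed.
- by move=> _ [w _ <-]; exact: Xp.
- by apply: within_continuous_borelV => //; exact: psi_C1.2.
Qed.

Let measurable_Fhat d0 (T0 : measurableType d0) (p : T0 -> bV) (s : T0 -> Om) :
  (forall w, X (p w)) -> measurable_fun setT p -> measurable_fun setT s ->
  measurable_fun setT ((fun w => Fhat (p w) (s w)) : T0 -> bV).
Proof.
move=> Xp mp ms.
apply: (@measurable_comp _ _ _ _ _ _ ((X : set bV) `*` setT)
  ((fun p => Fhat p.1 p.2) : bV * Om -> bV) setT (fun w => (p w, s w))).
- by apply: measurableX => //; exact: borelV_closed.
- by move=> _ [w _ <-]; split=> //=; exact: Xp.
- exact: Fhat_meas.
- exact: measurable_fun_pair.
Qed.

Let past_le d0 (U : measurableType d0) t (f : T -> U) :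
  measurable_fun (setT : set (past_type t)) f ->
  measurable_fun (setT : set (past_type t.+1)) f.
Proof. by apply: measurable_fun_sub_sigma; exact: past_gen_succ. Qed.

(** The index shift reflects the order of events: [y t] is known before sample [t] is drawn, [x t]
    only once it has been drawn. *)
Let measurable_xy t :
  measurable_fun (setT : set (past_type t.+1)) (x t : T -> bV) /\
  measurable_fun (setT : set (past_type t)) (y t : T -> bV).
Proof.
elim: t => [|t [mx my]].
  have -> : x 0%N = x0 by apply/funext => w; have [] := alg w.
  have -> : y 0%N = x0 by apply/funext => w; have [] := alg w.
  by split; exact: past_x0.
have myS : measurable_fun (setT : set (past_type t.+1)) (y t.+1 : T -> bV).
  (* Uniqueness turns the argmin relation into an application of the continuous map [prox]. *)
  have -> : y t.+1 = fun w => prox X psi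
      (gamma t *: Fhat (y t w) (xis t w) - dpsi (x t w)).
    apply/funext => w.
    exact: (argminE hnrm X_nonempty X_closed X_convex X_bounded alpha_gt0 psi_C1 psi_sc).
  apply: measurable_prox; apply: measurable_vecB; last exact: measurable_dpsi.
  by apply: measurable_vecZ; apply: measurable_Fhat => //; [exact: past_le|exact: past_xi].
split=> //.
have -> : x t.+1 = fun w => prox X psi
    (gamma t *: Fhat (y t.+1 w) (xis t.+1 w) - dpsi (x t w)).
  apply/funext => w.
  exact: (argminE hnrm X_nonempty X_closed X_convex X_bounded alpha_gt0 psi_C1 psi_sc).
apply: measurable_prox; apply: measurable_vecB; last first.
  by apply: measurable_dpsi => //; exact: past_le.
by apply: measurable_vecZ; apply: measurable_Fhat => //; [exact: past_le|exact: past_xi].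
Qed.

Let noise2 t w := conj_norm nrm (Fhat (y t w) (xis t w) - F (y t w)) ^+ 2.

Let noise2_int t : P.-integrable setT (EFin \o noise2 t).
Proof. by have [_ [E []]] := sampling_iterates t. Qed.

(** Over the whole space the conditional expectation has the same integral as the squared noise. *)
Let noise2_mean t : \int[P]_w noise2 t w <= sigma ^+ 2.
Proof.
have [_ [E [ni Ei _ nE] Es]] := sampling_iterates t.
have -> : \int[P]_w noise2 t w = \int[P]_w E w.
  congr fine; apply: nE.
  exact: (@measurableT _ (past_type t)).
have ci := integrable_cst_real P (sigma ^+ 2).
rewrite -subr_ge0; have -> : sigma ^+ 2 = \int[P]_w sigma ^+ 2.
  by rewrite Rintegral_cst_prob.
rewrite -RintegralB//; apply: Rintegral_ae_ge0; first exact: integrableB_real.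
by apply: filterS Es => w; rewrite subr_ge0.
Qed.

(** Stage [t] uses only [e 1], ..., [e t], so it is known as soon as sample [t] is, like
    [y t.+1]. *)
Fixpoint aux_iterate (p : 'rV[R]_n) (e : nat -> 'rV[R]_n) (t : nat) : 'rV[R]_n :=
  if t is s.+1 then
    prox X psi (- (gamma s *: e s.+1) - dpsi (aux_iterate p e s))
  else p.

Let aux_in p e t : X p -> X (aux_iterate p e t).
Proof. by case: t => //= t _; exact: prox_in. Qed.

(** The [9] is [5 + 4], the weights of two consecutive squared noises, each of mean at most
    [sigma ^+ 2]. *)
Lemma popov_mean_gap N :
  (\int[P]_w dual_gap X F (weighted_average gamma N (fun t => y t w)) <=
    ((\sum_(0 <= t < N.+1) (gamma t)^-1)^-1 *
     (2 * ((gamma N)^-1 ^+ 2 * D) +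
      N.+1%:R * ((2 * K ^+ 2 + 9 * sigma ^+ 2) / (2 * alpha))))%:E)%E.
Proof.
pose q t w := Fhat (y t w) (xis t w).
(* [F (y t _)] is not known to be measurable, so the noise is centered at a version of the
   conditional expectation of [q t], which is measurable with respect to the past. *)
have /choice[E hE] : forall ti : nat * 'I_n, exists E : T -> R,
    is_cond_exp P <<s past_gen ti.1 >> (fun w => q ti.1 w ord0 ti.2) E /\
    {ae P, forall w, E w = F (y ti.1 w) ord0 ti.2}.
  move=> [t i].
  by have [/(_ i)[E E1 E2] _] := sampling_iterates t; exists E.
pose Evec t w : 'rV[R]_n := \row_i E (t, i) w.
pose e t w := q t w - Evec t w.
pose u t w := aux_iterate (x0 w) (fun s => e s w) t.
have u_in t w : X (u t w) by exact: aux_in.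
have mE t : measurable_fun (setT : set (past_type t)) (Evec t : T -> bV).
  apply: measurable_rowP => i.
  rewrite (_ : (fun w => _) = E (t, i)); last by apply/funext => w; rewrite mxE.
  have [[_ _ mE _] _] := hE (t, i).
  by move=> _ B mB; rewrite setTI; exact: mE.
have mq t : measurable_fun (setT : set (past_type t.+1)) (q t : T -> bV).
  by apply: measurable_Fhat => //; [apply: past_le; have [] := measurable_xy t|exact: past_xi].
have me t : measurable_fun (setT : set (past_type t.+1)) (e t : T -> bV).
  by apply: measurable_vecB => //; exact: past_le.
have mu t : measurable_fun (setT : set (past_type t.+1)) (u t : T -> bV).
  elim: t => [|t IH]; first exact: past_x0.
  rewrite (_ : u t.+1 = fun w => prox X psi (- (gamma t *: e t.+1 w) - dpsi (u t w)))//.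
  apply: measurable_prox; apply: measurable_vecB.
    by apply: measurable_vecN; apply: measurable_vecZ.
  by apply: measurable_dpsi => //; exact: past_le.
have [C hC] := bounded_set_le X_bounded.
(* Coordinatewise, [e t.+1] integrates to zero over every event of [past_gen t.+1], while
   [y t.+1 - u t] is measurable for that sigma-algebra and bounded because [X] is. *)
have orth t : P.-integrable setT (EFin \o (fun w => inner (e t.+1 w) (y t.+1 w - u t w))) /\
    \int[P]_w inner (e t.+1 w) (y t.+1 w - u t w) = 0.
  have ei i : P.-integrable setT (EFin \o (fun w => e t.+1 w ord0 i)).
    have [[qi Ei _ _] _] := hE (t.+1, i).
    rewrite (_ : (fun w => _) = fun w => q t.+1 w ord0 i - E (t.+1, i) w).
      exact: integrableB_real.
    by apply/funext => w; rewrite !mxE.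
  have e0 i A : <<s past_gen t.+1 >> A -> \int[P]_(w in A) e t.+1 w ord0 i = 0.
    move=> SA; have mA := past_gen_sub SA.
    have [[qi Ei _ /(_ A SA) qE] _] := hE (t.+1, i).
    rewrite (_ : (fun w => _) = fun w => q t.+1 w ord0 i - E (t.+1, i) w).
      rewrite RintegralB//; [|exact: integrableS qi|exact: integrableS Ei].
      by rewrite /Rintegral qE subrr.
    by apply/funext => w; rewrite !mxE.
  pose v i w := (y t.+1 w - u t w) ord0 i.
  have mv i : measurable_fun (setT : set (past_type t.+1)) (v i).
    apply: measurable_coord_comp; apply: measurable_vecB => //.
    by have [] := measurable_xy t.+1.
  have vC i w : `|v i w| <= C + C.
    apply: le_trans (normr_coord _ _) _; apply: le_trans (ler_normB _ _) _.
    by rewrite lerD ?hC.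
  have evi i := integrable_mul_bounded (ei i)
    (measurable_fun_from_sub (@past_gen_sub _ _ _ _ _ _ _ x0 xis _) (mv i)) (vC i).
  split; first exact: integrable_sum_real.
  rewrite Rintegral_sum// big1// => i _.
  exact: (Rintegral_mul_orthogonal (@past_gen_sub _ _ _ _ _ _ _ x0 xis _)
    (ei i) (e0 i) (mv i) (vC i)).
pose term t w := (2 * alpha)^-1 * (2 * K ^+ 2 + 5 * noise2 t.+1 w + 4 * noise2 t w)
  - (gamma t)^-1 * inner (e t.+1 w) (y t.+1 w - u t w).
set S := \sum_(0 <= t < N.+1) _.
have S0 : 0 <= S^-1 by rewrite invr_ge0 sumr_ge0// => t _; rewrite invr_ge0 ltW.
have i1 t : P.-integrable setT (EFin \o
    (fun w => 2 * K ^+ 2 + 5 * noise2 t.+1 w + 4 * noise2 t w)).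
  apply: integrableD_real; last exact: integrableZ_real.
  by apply: integrableD_real; [exact: integrable_cst_real|exact: integrableZ_real].
have term_int t : P.-integrable setT (EFin \o term t).
  by apply: integrableB_real; apply: integrableZ_real => //; case: (orth t).
have term_mean t : \int[P]_w term t w <= (2 * K ^+ 2 + 9 * sigma ^+ 2) / (2 * alpha).
  have [ti t0] := orth t.
  rewrite RintegralB//; [|exact: integrableZ_real|exact: integrableZ_real].
  rewrite !RintegralZl// t0 mulr0 subr0 mulrC ler_wpM2r//.
    by rewrite invr_ge0 mulr_ge0// ltW.
  rewrite RintegralD//; last exact: integrableZ_real; last first.
    by apply: integrableD_real; [exact: integrable_cst_real|exact: integrableZ_real].
  rewrite RintegralD//; [|exact: integrable_cst_real|exact: integrableZ_real].
  rewrite Rintegral_cst_prob !RintegralZl//.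
  by have := noise2_mean t; have := noise2_mean t.+1; lra.
pose H w := S^-1 * (2 * ((gamma N)^-1 ^+ 2 * D) + \sum_(0 <= t < N.+1) term t w).
have sum_int : P.-integrable setT (EFin \o (fun w => \sum_(0 <= t < N.+1) term t w)).
  exact: integrable_sum_real.
have H_int : P.-integrable setT (EFin \o H).
  by apply: integrableZ_real; apply: integrableD_real => //; exact: integrable_cst_real.
apply: (@le_trans _ _ (\int[P]_w H w)%:E); last first.
  rewrite lee_fin RintegralZl//; last first.
    by apply: integrableD_real => //; exact: integrable_cst_real.
  rewrite ler_wpM2l// RintegralD//; last exact: integrable_cst_real.
  rewrite Rintegral_cst_prob lerD2l Rintegral_sum//.
  rewrite -[N.+1 in leRHS]subn0 mulr_natl -sumr_const_nat; exact: ler_sum.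
(* The gap is a supremum over a possibly uncountable set, so no measurability is claimed for it. It
   is nonnegative because the average lies in [X] and competes against itself. *)
apply: ge0_le_integral_ae => // [w|].
  have Xa : X (weighted_average gamma N (fun t => y t w)) by exact: weighted_average_in.
  apply: ereal_sup_ubound; exists (weighted_average gamma N (fun t => y t w)) => //=.
  by rewrite subrr inner0r.
(* Countably many exceptional null sets merge into one; off it [e t] is the true noise and the
   pathwise bound applies. *)
have ae_E : {ae P, forall w, forall t i, E (t, i) w = F (y t w) ord0 i}.
  apply: ae_foralln => t; apply: filter_forall => i.
  by have [] := hE (t, i).
apply: filterS ae_E => w wE.
have eE t : e t w = q t w - F (y t w).
  by rewrite /e; congr (_ - _); apply/rowP => i; rewrite mxE wE.
apply: le_trans (@popov_gap_bound _ _ _ hnrm _ X_convex _ alpha_gt0 _ _ psi_C1 psi_sc _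
  F_monotone _ gamma_gt0 gamma_decr _ D_bound (x ^~ w) (y ^~ w) (u ^~ w) (q ^~ w) (e ^~ w)
  _ N K_ge0 (x_in 0%N w) (u_in 0%N w) (y_in 0%N w) (y_argmin ^~ w) (x_argmin ^~ w) _ _ _) _.
- by move=> t; apply: (prox_argmin X_nonempty X_closed X_bounded psi_C1).
- by move=> t; rewrite eE opprB addrC subrK.
- by move=> t; exact: F_bound.
- rewrite lee_fin le_eqVlt; apply/orP; left; apply/eqP; rewrite /H.
  by congr (_ * (_ + _)); apply: eq_bigr => t _; rewrite /term /noise2 !eE.
Qed.

End PopovMean.

(** * Polynomially decaying step sizes *)

Section StepSize.
Context {R : realType} (c a : R).
Hypotheses (c_gt0 : 0 < c) (a_gt0 : 0 < a) (a_lt1 : a < 1).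

Lemma step_size_gt0 t : 0 < step_size c a t.
Proof. by rewrite divr_gt0// powR_gt0. Qed.

Lemma step_size_decr t : step_size c a t.+1 <= step_size c a t.
Proof.
rewrite ler_wpM2l ?(ltW c_gt0)// lef_pV2 ?posrE ?powR_gt0//.
by rewrite ge0_ler_powR ?nnegrE ?(ltW a_gt0)// ler_nat.
Qed.

Lemma inv_step_size t : (step_size c a t)^-1 = t.+1%:R `^ a / c.
Proof. by rewrite /step_size invf_div. Qed.

(** The inverse steps sum to at least [(N + 1) ^ (1 + a) / (c (1 + a))]. The first term then follows
    from [N ^ (1 - a) (N + 1) ^ a <= N + 1], the second from [N ^ a <= (N + 1) ^ a]; the factor
    [4 ^ a] in the first and one factor [2] in the second are slack. *)
Lemma step_size_rate (D Q : R) N : 0 <= D -> 0 <= Q -> (1 <= N)%N ->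
  (\sum_(0 <= t < N.+1) (step_size c a t)^-1)^-1 *
    (2 * ((step_size c a N)^-1 ^+ 2 * D) + N.+1%:R * Q)
  <= 2 * 4 `^ a * (1 + a) * D / (c * N%:R `^ (1 - a))
     + 2 * Q * c * (1 + a) / N%:R `^ a.
Proof.
move=> D0 Q0 N1; have a1 : 0 < 1 + a by rewrite addr_gt0.
have n0 : (0 : R) < N%:R by rewrite ltr0n.
have m0 : (0 : R) < N.+1%:R by [].
have nm : (N%:R : R) <= N.+1%:R by rewrite ler_nat.
under eq_bigr do rewrite inv_step_size.
rewrite -mulr_suml inv_step_size.
have := powR_sum_ge N.+1 a_gt0.
set s := \sum_(0 <= t < N.+1) _; set m : R := N.+1%:R in m0 nm *.
set p := m `^ a; set b := N%:R `^ a; set h := N%:R `^ (1 - a).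
have p0 : 0 < p by rewrite powR_gt0.
have b0 : 0 < b by rewrite powR_gt0.
have h0 : 0 < h by rewrite powR_gt0.
have -> : m `^ (1 + a) = m * p.
  by rewrite powRD ?powRr1 ?(ltW m0)// (gt_eqF m0) implybT.
move=> sge.
have bp : b <= p by rewrite ge0_ler_powR ?nnegrE ?(ltW a_gt0) ?(ltW m0).
have hp : h * p <= m.
  have -> : m = m `^ (1 - a) * p.
    by rewrite -powRD ?subrK ?powRr1 ?(ltW m0)// (gt_eqF m0) implybT.
  rewrite ler_wpM2r ?(ltW p0)// ge0_ler_powR ?nnegrE ?(ltW m0)// subr_ge0.
  exact: ltW.
have f1 : 1 <= 4 `^ a :> R by rewrite -[leLHS](powRr0 4) ler_powR ?(ltW a_gt0) ?ler1n.
have mp0 : 0 < m * p / (1 + a) by rewrite divr_gt0// mulr_gt0.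
have s0 : 0 < s by exact: lt_le_trans sge.
have sV : (s / c)^-1 <= c * (1 + a) / (m * p).
  have -> : c * (1 + a) / (m * p) = (m * p / (1 + a) / c)^-1.
    by field; rewrite !gt_eqF.
  rewrite lef_pV2 ?posrE; [|exact: divr_gt0|exact: divr_gt0].
  by rewrite ler_wpM2r// invr_ge0 ltW.
apply: le_trans (ler_wpM2r _ sV) _.
  by rewrite addr_ge0// mulr_ge0 ?(ltW m0)// mulr_ge0 ?sqr_ge0.
rewrite mulrDr lerD//.
  have -> : c * (1 + a) / (m * p) * (2 * ((p / c) ^+ 2 * D)) =
      (2 * (1 + a) * D / c) * (p / m).
    by field; rewrite !gt_eqF.
  have -> : 2 * 4 `^ a * (1 + a) * D / (c * h) =
      (2 * (1 + a) * D / c) * (4 `^ a / h).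
    by field; rewrite !gt_eqF.
  rewrite ler_wpM2l//; first by rewrite !mulr_ge0 ?invr_ge0// ltW.
  rewrite ler_pdivlMr// mulrAC ler_pdivrMr// mulrC.
  by apply: le_trans hp _; rewrite ler_peMl// ltW.
have -> : c * (1 + a) / (m * p) * (m * Q) = c * (1 + a) * Q * p^-1.
  by field; rewrite !gt_eqF.
have -> : 2 * Q * c * (1 + a) / b = c * (1 + a) * Q * (2 / b).
  by field; rewrite !gt_eqF.
rewrite ler_wpM2l//; first by rewrite !mulr_ge0// ltW.
apply: (@le_trans _ _ b^-1); first by rewrite lef_pV2.
by rewrite ler_peMl ?invr_ge0 ?(ltW b0)//; lra.
Qed.

End StepSize.

(** * Comparison with the constant of the final bound *)

Section Constants.
Context {R : realType} (alpha D sigma nu L M : R).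
Hypotheses (alpha_gt0 : 0 < alpha) (D_gt0 : 0 < D) (nu_ge0 : 0 <= nu)
  (L_gt0 : 0 < L) (M_ge0 : 0 <= M).

(** For [nu = 0] both sides agree. Otherwise, with [w] the power of the square root,
    [(L w + M) ^ 2 <= 2 L ^ 2 w ^ 2 + 2 M ^ 2], and the first term of [Dhat] is
    [8 L ^ 2 w ^ 2 / (2 alpha)]. *)
Lemma Dhat_ge (K := L * Num.sqrt (2 * D / alpha) `^ nu + M) :
  (2 * K ^+ 2 + 9 * sigma ^+ 2) / (2 * alpha) <= Dhat alpha D sigma nu L M.
Proof.
have s0 := sqr_ge0 sigma; have m0 := sqr_ge0 M.
have a20 : 0 < 2 * alpha by rewrite mulr_gt0.
rewrite /Dhat /K; case: eqP => [->|/eqP nu0].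
  by rewrite powRr0 mulr1 addrC.
have Da : 0 <= 2 * D / alpha by rewrite divr_ge0 ?mulr_ge0// ltW.
set w := Num.sqrt _ `^ nu.
have w2 : w ^+ 2 = 2 `^ nu * D `^ nu / alpha `^ nu.
  rewrite expr2 -[LHS]powRM ?sqrtr_ge0// -expr2 sqr_sqrtr//.
  rewrite powRM ?invr_ge0 ?mulr_ge0 ?(ltW alpha_gt0) ?(ltW D_gt0)//.
  by rewrite powRM ?(ltW D_gt0)// -powR_inv1 ?(ltW alpha_gt0)// powRAC powR_inv1 ?powR_ge0.
have -> : 2 `^ (2 + nu) * L ^+ 2 * D `^ nu / alpha `^ (1 + nu) =
    8 * L ^+ 2 * w ^+ 2 / (2 * alpha).
  rewrite w2 !powRD ?pnatr_eq0 ?(gt_eqF alpha_gt0) ?implybT//.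
  rewrite !powRr1 ?(ltW alpha_gt0)//.
  by field; rewrite !gt_eqF ?powR_gt0.
rewrite -mulrDl ler_wpM2r ?invr_ge0 ?(ltW a20)//.
have := sqr_ge0 (L * w - M); have := sqr_ge0 (L * w); rewrite !expr2 in s0 m0 *; lra.
Qed.

End Constants.

Theorem theorem8 (R : realType) (n : nat)
  (nrm : 'rV[R]_n -> R) (hnrm : is_norm nrm)
  (X : set 'rV[R]_n) (X_nonempty : X !=set0) (X_closed : closed X)
  (X_convex : convex_set X) (X_bounded : bounded_set X)
  (alpha : R) (alpha_gt0 : 0 < alpha)
  (psi : 'rV[R]_n -> R) (dpsi : 'rV[R]_n -> 'rV[R]_n)
  (psi_C1 : C1_on X psi dpsi)
  (psi_sc : strongly_convex_on nrm X alpha psi dpsi)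
  (d d' : measure_display) (T : measurableType d) (Om : measurableType d')
  (P : probability T R)
  (F : 'rV[R]_n -> 'rV[R]_n) (Fhat : 'rV[R]_n -> Om -> 'rV[R]_n)
  (Fhat_meas : jointly_measurable_on X Fhat)
  (xi : {RV P >-> Om})
  (F_mean : forall x, X x -> forall i : 'I_n,
     ('E_P[fun w => Fhat x (xi w) ord0 i] = (F x ord0 i)%:E)%E)
  (F_monotone : monotone_on X F)
  (nu L M : R) (nu_ge0 : 0 <= nu) (L_gt0 : 0 < L) (M_ge0 : 0 <= M)
  (F_growth : growth_on nrm X F nu L M)
  (c a : R) (c_gt0 : 0 < c) (a_gt0 : 0 < a) (a_lt1 : a < 1)
  (x0 : {RV P >-> borelV R n}) (x0_in : forall w, X (x0 w))
  (x0_L2 : ('E_P[fun w => (nrm (x0 w) ^+ 2)%R] < +oo)%E)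
  (xis : nat -> {RV P >-> Om})
  (x y : nat -> T -> 'rV[R]_n)
  (alg : popov X psi dpsi Fhat (step_size c a) x0 (fun t => xis t) x y)
  (sigma : R)
  (sampling : forall (z : 'rV[R]_n) (t : nat), X z ->
     sampling_at P nrm Fhat F sigma (past x0 (fun s => xis s) t)
       (xis t) (fun=> z))
  (sampling_iterates : forall t : nat,
     sampling_at P nrm Fhat F sigma (past x0 (fun s => xis s) t)
       (xis t) (y t))
  (D : R) (D_gt0 : 0 < D)
  (D_bound : forall x z, X x -> X z -> bregman psi dpsi z x <= D)
  (N : nat) (N_ge1 : (1 <= N)%N) :
  (\int[P]_w dual_gap X F
       (weighted_average (step_size c a) N (fun t => y t w))
   <= (2 * 4 `^ a * (1 + a) * D / (c * N%:R `^ (1 - a))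
       + 2 * Dhat alpha D sigma nu L M * c * (1 + a) / N%:R `^ a)%:E)%E.
Proof.
pose K := L * Num.sqrt (2 * D / alpha) `^ nu + M.
have K_ge0 : 0 <= K by rewrite addr_ge0// mulr_ge0 ?powR_ge0// ltW.
(* Strong convexity bounds the diameter of [X]: half of [alpha] times a squared distance is at most
   a divergence, hence at most [D]. *)
have nrm_diam u v : X u -> X v -> nrm (u - v) <= Num.sqrt (2 * D / alpha).
  move=> Xu Xv; rewrite -(ger0_norm (nrm_ge0 hnrm (u - v))) -sqrtr_sqr ler_wsqrtr//.
  have := le_trans (bregman_ge psi_sc Xv Xu) (D_bound v u Xv Xu).
  by rewrite mulrAC ler_pdivlMr// => h; lra.
(* On a set of bounded diameter the growth condition reduces to a constant bound, for every
   [nu >= 0] at once. *)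
have F_bound u v : X u -> X v -> conj_norm nrm (F u - F v) <= K.
  move=> Xu Xv; apply: le_trans (F_growth u v Xu Xv) _.
  rewrite lerD2r ler_wpM2l ?(ltW L_gt0)//.
  by rewrite ge0_ler_powR ?nnegrE ?sqrtr_ge0 ?(nrm_ge0 hnrm) ?nrm_diam.
have Q_ge0 : 0 <= (2 * K ^+ 2 + 9 * sigma ^+ 2) / (2 * alpha).
  apply: divr_ge0; last by rewrite mulr_ge0// ltW.
  by apply: addr_ge0; apply: mulr_ge0 => //; exact: sqr_ge0.
apply: le_trans (popov_mean_gap hnrm X_nonempty X_closed X_convex X_bounded alpha_gt0
  psi_C1 psi_sc Fhat_meas F_monotone (step_size_gt0 a c_gt0)
  (step_size_decr c_gt0 a_gt0) x0_in alg sampling_iterates D_bound K_ge0 F_bound N) _.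
rewrite lee_fin.
apply: le_trans (step_size_rate c_gt0 a_gt0 a_lt1 (ltW D_gt0) Q_ge0 N_ge1) _.
rewrite lerD2l ler_wpM2r ?invr_ge0 ?powR_ge0//.
rewrite ler_wpM2r ?addr_ge0 ?(ltW a_gt0)// ler_wpM2r ?(ltW c_gt0)// ler_wpM2l//.
exact: Dhat_ge.
Qed.
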